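(* Let $(X,\sigma,\tau)$ be a finite indecomposable solution of multipermutation level at most $2$. Then it is a homomorphic image of its canonical solution $\mathcal{C}(X,\sigma,\tau)$.
   Context: A solution $(X,\sigma,\tau)$ is a nonempty set $X$ with families of bijections $\sigma_x,\tau_x:X\to X$ ($x\in X$) such that $r(x,y)=(\sigma_x(y),\tau_y(x))$ satisfies $(\mathrm{id}\times r)(r\times\mathrm{id})(\mathrm{id}\times r)=(r\times\mathrm{id})(\mathrm{id}\times r)(r\times\mathrm{id})$ on $X^3$. It is indecomposable if $\langle\sigma_x,\tau_x: x\in X\rangle$ acts transitively on $X$. Put $x\approx y$ iff $\sigma_x=\sigma_y$ and $\tau_x=\tau_y$. The operations induced on $X/{\approx}$ are well defined and give a solution $\mathrm{Ret}(X)$. $X$ has multipermutation level at most $2$ if $|\mathrm{Ret}(\mathrm{Ret}(X))|=1$. $U(x)=\sigma_x^{-1}(x)$ and $T(x)=\tau_x^{-1}(x)$ are commuting permutations of $X$. $\mathrm{Dis}(X)=\langle\sigma_x\sigma_y^{-1},\tau_x\tau_y^{-1}:x,y\in X\rangle$ (abelian when the level is at most $2$), and $\mathrm{Dis}(X)_e$ is the stabilizer of $e$. $\mathbb{Z}_n=\mathbb{Z}/n\mathbb{Z}$. For an abelian group $G$ and sequences $\mathbf{c},\mathbf{d}$ in $G$ indexed by $\mathbb{Z}_n$, with $c_0=d_0=0$ and $G=\langle c_i,d_i\mid i\in\mathbb{Z}_n\rangle$, $\mathcal{S}(G\times\mathbb{Z}_n^2,\mathbf{c},\mathbf{d})$ is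 the solution $(Y,\lambda,\rho)$ on $Y=G\times\mathbb{Z}_n^2$ given by $\lambda_{(a,i,i')}((b,j,j'))=(b+c_{i-i'+j'-j-1},j+1,j')$ and $\rho_{(a,i,i')}((b,j,j'))=(b+d_{i-i'+j'-j+1},j,j'+1)$. Canonical solution: fix any $\tilde 0\in X$ and put $\tilde i=T^i(\tilde 0)$ for $i\in\mathbb{Z}$. Let $G=\mathrm{Dis}(X)/\mathrm{Dis}(X)_{\tilde 0}$, $n=\mathrm{lcm}(o(U),o(T))$ where $o$ denotes the order of a permutation, $c_i=\sigma_{\tilde i}\sigma_{\tilde 0}^{-1}\mathrm{Dis}(X)_{\tilde 0}$ and $d_i=\tau_{\tilde i}\tau_{\tilde 0}^{-1}\mathrm{Dis}(X)_{\tilde 0}$ for $i\in\mathbb{Z}_n$. Then $\mathcal{C}(X,\sigma,\tau)=\mathcal{S}(G\times\mathbb{Z}_n^2,\mathbf{c},\mathbf{d})$. A homomorphism $\Phi:(Y,\lambda,\rho)\to(X,\sigma,\tau)$ is a map with $\Phi\lambda_y=\sigma_{\Phi(y)}\Phi$ and $\Phi\rho_y=\tau_{\Phi(y)}\Phi$ for all $y\in Y$; $X$ is a homomorphic image of $Y$ if there is a surjective homomorphism $Y\to X$. *)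

(* Defs.v *)
From mathcomp Require Import all_boot ssralg zmodp fingroup morphism perm cyclic.
From mathcomp Require Import automorphism quotient action generic_quotient.

Set Implicit Arguments.
Unset Strict Implicit.
Unset Printing Implicit Defensive.

Import GroupScope GRing.Theory.

Local Open Scope quotient_scope.

Section BraidRelation.

Variables (X : finType) (sg ta : X -> {perm X}).

Definition rmap (p : X * X) : X * X := (sg p.1 p.2, ta p.2 p.1).

Definition r_x_id (p : X * X * X) : X * X * X :=
  let: (x, y, z) := p in (rmap (x, y), z).

Definition id_x_r (p : X * X * X) : X * X * X :=
  let: (x, y, z) := p in (x, (rmap (y, z)).1, (rmap (y, z)).2).

Definition braid_relation : Prop :=
  forall p, id_x_r (r_x_id (id_x_r p)) = r_x_id (id_x_r (r_x_id p)).

Lemma braid_relationP :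
  braid_relation <->
  forall x y z,
    [/\ sg x (sg y z) = sg (sg x y) (sg (ta y x) z),
        sg (ta (sg y z) x) (ta z y) = ta (sg (ta y x) z) (sg x y)
      & ta (ta z y) (ta (sg y z) x) = ta z (ta y x)].
Proof.
split=> [H x y z | H [[x y] z]].
  by have := H (x, y, z); rewrite /= => -[].
by rewrite /=; have [-> -> ->] := H x y z.
Qed.

End BraidRelation.

(* Only finite solutions are considered, hence the finite carrier and the
   families of permutations. *)
Record solution := Solution {
  carrier :> finType;
  sigma : carrier -> {perm carrier};
  tau : carrier -> {perm carrier};
  solution_nonempty : 0 < #|carrier|;
  solution_braid : braid_relation sigma tau
}.

Section Theory.

Variable X : solution.
Implicit Types x y z : X.

Lemma braid1 x y z : sigma x (sigma y z) = sigma (sigma x y) (sigma (tau y x) z).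
Proof. by have /braid_relationP/(_ x y z)[] := @solution_braid X. Qed.

Lemma braid2 x y z :
  sigma (tau (sigma y z) x) (tau z y) = tau (sigma (tau y x) z) (sigma x y).
Proof. by have /braid_relationP/(_ x y z)[] := @solution_braid X. Qed.

Lemma braid3 x y z : tau (tau z y) (tau (sigma y z) x) = tau z (tau y x).
Proof. by have /braid_relationP/(_ x y z)[] := @solution_braid X. Qed.

(* In {perm X} the product s * t is "s first, then t". *)

Lemma sigmaM x y : sigma y * sigma x = sigma (tau y x) * sigma (sigma x y).
Proof. by apply/permP=> z; rewrite !permM braid1. Qed.

Lemma tauM y z : tau y * tau z = tau (sigma y z) * tau (tau z y).
Proof. by apply/permP=> x; rewrite !permM braid3. Qed.

Definition perm_group : {group {perm X}} :=
  <<[set sigma x | x : X] :|: [set tau x | x : X]>>%G.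

Definition indecomposable : bool := [transitive perm_group, on [set: X] | 'P].

Definition approx : rel X := fun x y => (sigma x == sigma y) && (tau x == tau y).

Lemma approx_refl : reflexive approx.
Proof. by move=> x; rewrite /approx !eqxx. Qed.

Lemma approx_sym : symmetric approx.
Proof. by move=> x y; rewrite /approx eq_sym [in X in _ && X]eq_sym. Qed.

Lemma approx_trans : transitive approx.
Proof. by move=> y x z /andP[/eqP H1 /eqP H2]; rewrite /approx H1 H2. Qed.

Canonical approx_equiv := EquivRel approx approx_refl approx_sym approx_trans.

Lemma approx_sigma x x' y y' :
  approx x x' -> approx y y' -> approx (sigma x y) (sigma x' y').
Proof.
move=> /andP[/eqP Hx _] /andP[/eqP Hs /eqP Ht]; rewrite -Hx /approx.
apply/andP; split; apply/eqP.
  apply: (mulgI (sigma (tau y x))).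
  by rewrite -sigmaM Hs Ht -sigmaM.
have E u : tau (sigma x u) = (tau x * tau u) * (tau (tau u x))^-1.
  by rewrite tauM mulgK.
by rewrite !E Ht.
Qed.

Lemma approx_tau x x' y y' :
  approx x x' -> approx y y' -> approx (tau x y) (tau x' y').
Proof.
move=> /andP[_ /eqP Hx] /andP[/eqP Hs /eqP Ht]; rewrite -Hx /approx.
apply/andP; split; apply/eqP.
  have E u : sigma (tau x u) = (sigma x * sigma u) * (sigma (sigma u x))^-1.
    by rewrite sigmaM mulgK.
  by rewrite !E Hs.
apply: (mulgI (tau (sigma y x))).
by rewrite -tauM Hs Ht -tauM.
Qed.

End Theory.

Arguments approx {X}.

Section Retraction.

Variable X : solution.

Definition Ret_carrier : finType := quot_type {eq_quot (@approx X)}.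

Definition ret_class (x : X) : Ret_carrier := \pi_({eq_quot (@approx X)})%qT x.
Definition ret_repr (a : Ret_carrier) : X := repr (a : {eq_quot (@approx X)}).

Lemma ret_reprK : cancel ret_repr ret_class.
Proof. exact: reprK. Qed.

Lemma ret_classP (x y : X) : reflect (ret_class x = ret_class y) (approx x y).
Proof. by apply: (iffP idP) => [|] /eqmodP. Qed.

Lemma approx_repr (x : X) : approx (ret_repr (ret_class x)) x.
Proof. by apply/ret_classP; rewrite ret_reprK. Qed.

Definition Ret_sigma_fun (a b : Ret_carrier) : Ret_carrier :=
  ret_class (sigma (ret_repr a) (ret_repr b)).
Definition Ret_tau_fun (a b : Ret_carrier) : Ret_carrier :=
  ret_class (tau (ret_repr a) (ret_repr b)).

Lemma Ret_sigma_funE x y :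
  Ret_sigma_fun (ret_class x) (ret_class y) = ret_class (sigma x y).
Proof. by apply/ret_classP/approx_sigma; apply: approx_repr. Qed.

Lemma Ret_tau_funE x y :
  Ret_tau_fun (ret_class x) (ret_class y) = ret_class (tau x y).
Proof. by apply/ret_classP/approx_tau; apply: approx_repr. Qed.

Lemma fin_surj_inj (T : finType) (f : T -> T) :
  (forall y, exists x, f x = y) -> injective f.
Proof.
move=> fS; have /image_injP inj : #|image f T| == #|T|.
  rewrite eqn_leq leq_image_card; apply/subset_leq_card/subsetP=> y _.
  by have [x <-] := fS y; apply: image_f.
by move=> x y; apply: inj.
Qed.

Lemma Ret_sigma_inj a : injective (Ret_sigma_fun a).
Proof.
apply: fin_surj_inj => b; exists (ret_class ((sigma (ret_repr a))^-1 (ret_repr b))).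
by rewrite -{1}(ret_reprK a) Ret_sigma_funE permKV ret_reprK.
Qed.

Lemma Ret_tau_inj a : injective (Ret_tau_fun a).
Proof.
apply: fin_surj_inj => b; exists (ret_class ((tau (ret_repr a))^-1 (ret_repr b))).
by rewrite -{1}(ret_reprK a) Ret_tau_funE permKV ret_reprK.
Qed.

Definition Ret_sigma (a : Ret_carrier) : {perm Ret_carrier} := perm (@Ret_sigma_inj a).
Definition Ret_tau (a : Ret_carrier) : {perm Ret_carrier} := perm (@Ret_tau_inj a).

Lemma Ret_sigmaE x y : Ret_sigma (ret_class x) (ret_class y) = ret_class (sigma x y).
Proof. by rewrite permE Ret_sigma_funE. Qed.

Lemma Ret_tauE x y : Ret_tau (ret_class x) (ret_class y) = ret_class (tau x y).
Proof. by rewrite permE Ret_tau_funE. Qed.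

Lemma Ret_nonempty : 0 < #|Ret_carrier|.
Proof.
by have /card_gt0P[x _] := solution_nonempty X; apply/card_gt0P; exists (ret_class x).
Qed.

Lemma Ret_braid : braid_relation Ret_sigma Ret_tau.
Proof.
apply/braid_relationP => a b c.
rewrite -(ret_reprK a) -(ret_reprK b) -(ret_reprK c) !(Ret_sigmaE, Ret_tauE).
by rewrite braid1 braid2 braid3.
Qed.

Definition Ret : solution := Solution Ret_nonempty Ret_braid.

End Retraction.

Definition mpl_le2 (X : solution) : Prop := #|Ret (Ret X)| = 1%N.

Section Diagonal.

Variable X : solution.
Implicit Types x y z u : X.

Definition U_fun x : X := (sigma x)^-1 x.
Definition T_fun x : X := (tau x)^-1 x.

Lemma sigma_U x : sigma x (U_fun x) = x. Proof. exact: permKV. Qed.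
Lemma tau_T x : tau x (T_fun x) = x. Proof. exact: permKV. Qed.

Lemma sigma_tauU x : sigma (tau (U_fun x) x) = sigma (U_fun x).
Proof. by apply: (mulIg (sigma x)); rewrite [RHS]sigmaM sigma_U. Qed.

Lemma tau_sigmaT x : tau (sigma (T_fun x) x) = tau (T_fun x).
Proof. by apply: (mulIg (tau x)); rewrite [RHS]tauM tau_T. Qed.

Lemma tauU x :
  tau (U_fun x) x = sigma (U_fun x) (tau (U_fun (U_fun x)) (U_fun x)).
Proof.
have := braid2 x (U_fun x) (U_fun (U_fun x)).
by rewrite sigma_tauU !sigma_U sigma_tauU.
Qed.

Lemma sigmaT x :
  sigma (T_fun x) x = tau (T_fun x) (sigma (T_fun (T_fun x)) (T_fun x)).
Proof.
have := braid2 (T_fun (T_fun x)) (T_fun x) x.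
by rewrite tau_sigmaT !tau_T tau_sigmaT.
Qed.

Lemma U_inj : injective U_fun.
Proof.
move=> x y Exy; have := tauU x; rewrite Exy -tauU.
exact: perm_inj.
Qed.

Lemma T_inj : injective T_fun.
Proof.
move=> x y Exy; have := sigmaT x; rewrite Exy -sigmaT.
exact: perm_inj.
Qed.

Definition Uperm : {perm X} := perm U_inj.
Definition Tperm : {perm X} := perm T_inj.

(* (sigma y)^-1 * sigma x is the composite of sigma_x after sigma_y^-1,
   since products of permutations are applied from left to right. *)
Definition Dis : {group {perm X}} :=
  <<([set (sigma y)^-1 * sigma x | x : X, y : X]
     :|: [set (tau y)^-1 * tau x | x : X, y : X])%g>>%G.

Definition Dis_stab (e : X) : {group {perm X}} := 'C_Dis[e | 'P]%G.

Lemma sigma_Dis x y : (sigma y)^-1 * sigma x \in Dis.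
Proof. by apply/mem_gen/setUP; left; apply: imset2_f. Qed.

Lemma tau_Dis x y : (tau y)^-1 * tau x \in Dis.
Proof. by apply/mem_gen/setUP; right; apply: imset2_f. Qed.

Definition tilde (e : X) (i : nat) : X := (Tperm ^+ i) e.

End Diagonal.

Section Level2.

Variable X : solution.
Hypothesis lev2 : mpl_le2 X.
Implicit Types x y z u : X.

Lemma RetRet_eq (p q : Ret (Ret X)) : p = q.
Proof. by have [r Er] := fintype1 lev2; rewrite (Er p) (Er q). Qed.

Lemma approx_Ret (a b : Ret X) : approx a b.
Proof. by apply/ret_classP; apply: RetRet_eq. Qed.

Lemma level2_sigma x x' y : approx (sigma x y) (sigma x' y).
Proof.
apply/ret_classP; rewrite -!Ret_sigmaE.
have /andP[/eqP E _] := approx_Ret (ret_class x) (ret_class x').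
by have := congr1 (fun s : {perm Ret X} => s (ret_class y)) E; exact: id.
Qed.

Lemma level2_tau x x' y : approx (tau x y) (tau x' y).
Proof.
apply/ret_classP; rewrite -!Ret_tauE.
have /andP[_ /eqP E] := approx_Ret (ret_class x) (ret_class x').
by have := congr1 (fun s : {perm Ret X} => s (ret_class y)) E; exact: id.
Qed.

Lemma sigma_sigma x x' y : sigma (sigma x y) = sigma (sigma x' y).
Proof. by have /andP[/eqP] := level2_sigma x x' y. Qed.
Lemma sigma_tau x x' y : sigma (tau x y) = sigma (tau x' y).
Proof. by have /andP[/eqP] := level2_tau x x' y. Qed.
Lemma tau_sigma x x' y : tau (sigma x y) = tau (sigma x' y).
Proof. by have /andP[_ /eqP] := level2_sigma x x' y. Qed.
Lemma tau_tau x x' y : tau (tau x y) = tau (tau x' y).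
Proof. by have /andP[_ /eqP] := level2_tau x x' y. Qed.

Lemma conj_sigma_sigma x y b :
  ((sigma y)^-1 * sigma x) ^ (sigma b)^-1 =
  (sigma (tau y y))^-1 * sigma (tau x x).
Proof.
set a := (sigma y)^-1 b.
have Eb u : sigma (sigma u a) = sigma b by rewrite (sigma_sigma u y) permKV.
have E u : sigma (tau u u) = sigma a * sigma u * (sigma b)^-1.
  by rewrite (sigma_tau u a) sigmaM Eb mulgK.
by rewrite !E conjgE invgK !invMg !invgK !mulgA mulgKV.
Qed.

Lemma conj_tau_tau x y b :
  ((tau y)^-1 * tau x) ^ (tau b)^-1 =
  (tau (sigma y y))^-1 * tau (sigma x x).
Proof.
set a := (tau y)^-1 b.
have Eb u : tau (tau u a) = tau b by rewrite (tau_tau u y) permKV.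
have E u : tau (sigma u u) = tau a * tau u * (tau b)^-1.
  by rewrite (tau_sigma u a) tauM Eb mulgK.
by rewrite !E conjgE invgK !invMg !invgK !mulgA mulgKV.
Qed.

Lemma conj_sigma_tau x y b :
  ((sigma y)^-1 * sigma x) ^ (tau b) =
  (sigma (tau y y))^-1 * sigma (tau x x).
Proof.
set a := (sigma b)^-1 b.
have Eb u : tau (sigma u a) = tau b by rewrite (tau_sigma u b) permKV.
have E u : sigma u * tau b = tau a * sigma (tau u u).
  apply/permP=> w; rewrite !permM (sigma_tau u (sigma w a)) braid2.
  by rewrite Eb.
have E' u : sigma (tau u u) = (tau a)^-1 * sigma u * tau b by rewrite -mulgA E mulKg.
by rewrite !E' conjgE !invMg !invgK !mulgA mulgK.
Qed.

Lemma conj_sigma_tauV x y b :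
  ((sigma y)^-1 * sigma x) ^ (tau b)^-1 =
  (sigma (T_fun y))^-1 * sigma (T_fun x).
Proof.
apply: (conjg_inj (tau b)); rewrite conjgKV conj_sigma_tau.
by rewrite (sigma_tau _ x (T_fun x)) (sigma_tau _ y (T_fun y)) !tau_T.
Qed.

Lemma commute_conj (gT : finGroupType) (p q s : gT) :
  s ^ p = s ^ q -> commute s (p * q^-1).
Proof. by move=> E; apply/commgP/conjg_fixP; rewrite conjgM E conjgK. Qed.

Lemma Dis_abelian : abelian (Dis X).
Proof.
have css x y z w :
  commute ((sigma y)^-1 * sigma x) ((sigma w)^-1 * sigma z).
  rewrite -[sigma z]invgK; apply: commute_conj.
  by rewrite !conj_sigma_sigma.
have ctt x y z w : commute ((tau y)^-1 * tau x) ((tau w)^-1 * tau z).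
  rewrite -[tau z]invgK; apply: commute_conj.
  by rewrite !conj_tau_tau.
have cst x y z w : commute ((sigma y)^-1 * sigma x) ((tau w)^-1 * tau z).
  rewrite -[tau z]invgK; apply: commute_conj.
  by rewrite !conj_sigma_tauV.
rewrite abelian_gen abelianE; apply/centsP => p Hp q Hq.
case/setUP: Hp => /imset2P[x y _ _ ->]; case/setUP: Hq => /imset2P[z w _ _ ->].
- exact: css.
- exact: cst.
- exact/commute_sym/cst.
exact: ctt.
Qed.

(* Modulo approx, sigma and tau are mutually inverse. *)
Lemma approx_sigma_tau x y z : approx (sigma y (tau z x)) x.
Proof.
have ES w v : sigma (sigma w (tau v x)) = sigma x.
  have E := sigma_tauU (sigma w x).
  have A : approx (U_fun (sigma w x)) x.
    apply/ret_classP; apply: (@perm_inj _ (Ret_sigma (ret_class w))).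
    rewrite !Ret_sigmaE; apply/ret_classP.
    by rewrite -{2}(sigma_U (sigma w x)); apply: level2_sigma.
  have /andP[/eqP <- _] := A; rewrite -E.
  suff: approx (sigma w (tau v x)) (tau (U_fun (sigma w x)) (sigma w x)).
    by case/andP=> /eqP.
  apply: (@approx_trans _ (tau v (sigma w x))); last exact: level2_tau.
  have B := braid2 w x v.
  apply: (@approx_trans _ (sigma (tau (sigma x v) w) (tau v x))).
    exact: level2_sigma.
  by rewrite B; apply: level2_tau.
have ET w v : tau (sigma w (tau v x)) = tau x.
  have E := tau_sigmaT (tau v x).
  have A : approx (T_fun (tau v x)) x.
    apply/ret_classP; apply: (@perm_inj _ (Ret_tau (ret_class v))).
    rewrite !Ret_tauE; apply/ret_classP.
    by rewrite -{2}(tau_T (tau v x)); apply: level2_tau.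
  have /andP[_ /eqP <-] := A; rewrite -E.
  suff: approx (sigma w (tau v x)) (sigma (T_fun (tau v x)) (tau v x)).
    by case/andP=> _ /eqP.
  exact: level2_sigma.
by rewrite /approx ES ET !eqxx.
Qed.

End Level2.

(* Z/nZ for n > 0, including n = 1 (where MathComp's 'Z_n would not do). *)
Notation Zmod n := 'I_(n.-1.+1).

Section Affine.

(* The abelian group G is written multiplicatively. *)
Variables (gT : finGroupType) (n : nat) (c d : Zmod n -> gT).

Record affine_data : Prop := AffineData {
  affine_n_gt0 : 0 < n;
  affine_abelian : abelian [set: gT];
  affine_c0 : c 0%R = 1;
  affine_d0 : d 0%R = 1;
  affine_gen : <<[set c i | i : Zmod n] :|: [set d i | i : Zmod n]>> = [set: gT]
}.

Definition affine_carrier : finType := (gT * Zmod n * Zmod n)%type.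

Definition affine_lambda_fun (x y : affine_carrier) : affine_carrier :=
  let: (_, i, i') := x in let: (b, j, j') := y in
  (b * c (i - i' + j' - j - Zp1)%R, (j + Zp1)%R, j').

Definition affine_rho_fun (x y : affine_carrier) : affine_carrier :=
  let: (_, i, i') := x in let: (b, j, j') := y in
  (b * d (i - i' + j' - j + Zp1)%R, j, (j' + Zp1)%R).

Lemma affine_lambda_inj x : injective (affine_lambda_fun x).
Proof.
case: x => [[a i] i'] [[b j] j'] [[b1 j1] j1'] E.
have /= Ej' := congr1 snd E; have /= /addIr Ej := congr1 (snd \o fst) E.
by have := congr1 (fst \o fst) E; rewrite /= Ej' Ej => /mulIg ->.
Qed.

Lemma affine_rho_inj x : injective (affine_rho_fun x).
Proof.
case: x => [[a i] i'] [[b j] j'] [[b1 j1] j1'] E.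
have /= /addIr Ej' := congr1 snd E; have /= Ej := congr1 (snd \o fst) E.
by have := congr1 (fst \o fst) E; rewrite /= Ej' Ej => /mulIg ->.
Qed.

Definition affine_lambda x : {perm affine_carrier} := perm (@affine_lambda_inj x).
Definition affine_rho x : {perm affine_carrier} := perm (@affine_rho_inj x).

Hypothesis cd : affine_data.

Lemma affine_nonempty : 0 < #|affine_carrier|.
Proof. by apply/card_gt0P; exists (1, 0%R, 0%R). Qed.

Lemma affine_mulC (a b : gT) : a * b = b * a.
Proof. by have /centsP := affine_abelian cd; apply; rewrite inE. Qed.

Lemma affine_braid : braid_relation affine_lambda affine_rho.
Proof.
apply/braid_relationP => -[[a i] i'] [[b j] j'] [[e k] k'].
have ACg (u v w : gT) : u * v * w = u * w * v by rewrite -!mulgA (affine_mulC v).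
split; rewrite !permE /=; [rewrite ACg | | rewrite ACg]; rewrite !opprD !addrA.
- congr (_ * c _ * c _, _, _); first by rewrite [RHS](ACl (1*2*4*5*3*6))%AC.
  by rewrite [RHS](ACl (1*3*4*5*6*2*7))%AC /= addrK.
- rewrite ACg; congr (_ * c _ * d _, _, _).
    by rewrite [LHS](ACl (1*2*4*6*7*5*3))%AC /= addrK.
  by rewrite [RHS](ACl (1*3*4*5*7*2*6))%AC /= addrK.
congr (_ * d _ * d _, _, _).
  by rewrite [LHS](ACl (1*2*4*6*7*5*3))%AC /= addrK.
by rewrite [LHS](ACl (1*3*4*2*5*6))%AC.
Qed.

Definition affine_solution : solution := Solution affine_nonempty affine_braid.

End Affine.

Section Canonical.

Variable X : solution.
Variable e : X.

Definition canon_group : {group coset_of (Dis_stab e)} := (Dis X / Dis_stab e)%G.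

Definition canon_n : nat := lcmn #[Uperm X] #[Tperm X].

(* subg corestricts to the quotient group; its argument does lie there, by
   sigma_Dis and tau_Dis. *)
Definition canon_c (i : Zmod canon_n) : subg_of canon_group :=
  subg canon_group (coset (Dis_stab e) ((sigma e)^-1 * sigma (tilde e i))).

Definition canon_d (i : Zmod canon_n) : subg_of canon_group :=
  subg canon_group (coset (Dis_stab e) ((tau e)^-1 * tau (tilde e i))).

Hypothesis indec : indecomposable X.
Hypothesis lev2 : mpl_le2 X.

Lemma canon_n_gt0 : 0 < canon_n.
Proof. by rewrite lcmn_gt0 !order_gt0. Qed.

Lemma canon_abelian : abelian [set: subg_of canon_group].
Proof.
have : abelian canon_group by apply/quotient_abelian/Dis_abelian.
move=> /centsP ab; apply/centsP => x _ y _.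
by apply: val_inj; apply: ab; apply: subgP.
Qed.

Lemma tilde_mod i : tilde e (i %% canon_n) = tilde e i.
Proof.
rewrite /tilde expg_mod //; apply/eqP; rewrite -order_dvdn.
exact: dvdn_lcmr.
Qed.

Lemma approx_Tperm x y : approx (sigma y x) (Tperm X x).
Proof. by rewrite permE -{1}(tau_T x); apply: approx_sigma_tau. Qed.

Lemma approx_TpermV x y : approx (tau y x) ((Tperm X)^-1 x).
Proof.
have {1}-> : x = T_fun ((Tperm X)^-1 x) by rewrite -[RHS](permE (@T_inj X)) permKV.
rewrite -{2}(tau_T ((Tperm X)^-1 x)); exact: level2_tau.
Qed.

Lemma tilde_approx_nat x (k : nat) :
  approx x (tilde e k) -> exists i : Zmod canon_n, approx x (tilde e i).
Proof.
have n_eq : canon_n.-1.+1 = canon_n by rewrite prednK // canon_n_gt0.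
move=> Hx; have lt : k %% canon_n < canon_n.-1.+1 by rewrite n_eq ltn_mod canon_n_gt0.
by exists (Ordinal lt); rewrite /= tilde_mod.
Qed.

Lemma tilde_approx x : exists i : Zmod canon_n, approx x (tilde e i).
Proof.
pose S := [set y | [exists i : Zmod canon_n, approx y (tilde e i)]].
have S_e : e \in S.
  rewrite inE; apply/existsP; apply: (@tilde_approx_nat _ 0).
  by rewrite /tilde expg0 perm1; apply: approx_refl.
have nS : perm_group X \subset 'N(S | 'P).
  rewrite gen_subG; apply/subsetP => _ /setUP[] /imsetP[y _ ->];
    rewrite !inE /=; apply/subsetP => z; rewrite !inE => /existsP[i Hi];
    apply/existsP; move: (nat_of_ord i) Hi => {}i Hi.
  - apply: (@tilde_approx_nat _ i.+1); rewrite /tilde expgSr permM.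
    apply: (@approx_trans _ (sigma y (tilde e i))); last exact: approx_Tperm.
    by apply: approx_sigma => //; apply: approx_refl.
  apply: (@tilde_approx_nat _ (i + canon_n.-1)).
  have -> : tilde e (i + canon_n.-1) = (Tperm X)^-1 (tilde e i).
    apply: (canRL (permK (Tperm X))).
    rewrite -permM -expgSr -addnS prednK ?canon_n_gt0 // -[LHS]tilde_mod.
    by rewrite modnDr tilde_mod.
  apply: (@approx_trans _ (tau y (tilde e i))); last exact: approx_TpermV.
  by apply: approx_tau => //; apply: approx_refl.
have [a Ga ->] := atransP2 indec (in_setT e) (in_setT x).
have : 'P%act e a \in S by rewrite (astabs_act _ (subsetP nS a Ga)).
by rewrite inE => /existsP.
Qed.

Lemma Dis_norm : Dis X \subset 'N(Dis_stab e).
Proof. exact: sub_abelian_norm (Dis_abelian lev2) (subsetIl _ _). Qed.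

Lemma sgval_canon p : p \in Dis X ->
  sgval (subg canon_group (coset (Dis_stab e) p)) = coset (Dis_stab e) p.
Proof. by move=> Dp; rewrite subgK //; apply: mem_quotient. Qed.

Lemma canon_data : affine_data canon_c canon_d.
Proof.
have canon0 (s : X -> {perm X}) :
    subg canon_group (coset (Dis_stab e) ((s e)^-1 * s (tilde e 0))) = 1.
  by rewrite /tilde expg0 perm1 mulVg coset_id ?group1 // morph1.
split; [exact: canon_n_gt0 | exact: canon_abelian | exact: canon0 | exact: canon0 |].
set A := _ :|: _; apply/eqP; rewrite eqEsubset subsetT; apply/subsetP => g _.
have genD (s : X -> {perm X}) (cs : Zmod canon_n -> subg_of canon_group) x y :
    (forall x y, (s y)^-1 * s x \in Dis X) ->
    (forall x, exists i : Zmod canon_n, s x = s (tilde e i)) ->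
    (forall i, cs i = subg canon_group (coset (Dis_stab e) ((s e)^-1 * s (tilde e i)))) ->
    (forall i, cs i \in A) ->
    coset (Dis_stab e) ((s y)^-1 * s x) \in sgval @* <<A>>.
  move=> sD st csE csA; have [i ->] := st x; have [j ->] := st y.
  have -> : (s (tilde e j))^-1 * s (tilde e i) =
            ((s e)^-1 * s (tilde e j))^-1 * ((s e)^-1 * s (tilde e i)).
    by rewrite invMg invgK mulgA mulgK.
  have N z : (s e)^-1 * s z \in 'N(Dis_stab e) by rewrite (subsetP Dis_norm).
  rewrite (morphM (coset_morphism _)) ?groupV // (morphV (coset_morphism _)) //=.
  rewrite -(sgval_canon (sD (tilde e i) e)) -(sgval_canon (sD (tilde e j) e)) -!csE.
  have M k : sgval (cs k) \in sgval @* <<A>>.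
    by apply: (mem_morphim (sgval_morphism _)); [rewrite inE | apply: mem_gen].
  by rewrite groupM ?groupV.
have sub : canon_group \subset sgval @* <<A>>.
  rewrite /= /quotient morphim_gen; last exact: subset_trans (subset_gen _) Dis_norm.
  rewrite gen_subG; apply/subsetP => _ /morphimP[p _ Hp ->].
  have app x : exists i : Zmod canon_n,
      sigma x = sigma (tilde e i) /\ tau x = tau (tilde e i).
    by have [i /andP[/eqP E1 /eqP E2]] := tilde_approx x; exists i.
  case/setUP: Hp => /imset2P[x y _ _ ->].
  - apply: (@genD (@sigma X) canon_c) => // [|z|i]; first exact: sigma_Dis.
      by have [i []] := app z; exists i.
    by apply/setUP; left; apply: imset_f.
  apply: (@genD (@tau X) canon_d) => // [|z|i]; first exact: tau_Dis.
    by have [i []] := app z; exists i.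
  by apply/setUP; right; apply: imset_f.
have /morphimP[k _ Ak] := subsetP sub _ (subgP g).
by move/val_inj->.
Qed.

Definition canonical_solution : solution := affine_solution canon_data.

End Canonical.

Definition homomorphism (Y X : solution) (Phi : Y -> X) : Prop :=
  forall y : Y,
    (forall z, Phi (sigma y z) = sigma (Phi y) (Phi z)) /\
    (forall z, Phi (tau y z) = tau (Phi y) (Phi z)).

Definition homomorphic_image (X Y : solution) : Prop :=
  exists2 Phi : Y -> X, homomorphism Phi & forall x, exists y, Phi y = x.

(* Main.v *)
Require Import Defs.
From mathcomp Require Import all_boot.
From mathcomp Require Import ssralg zmodp fingroup morphism perm cyclic quotient.
From mathcomp Require Import action.

(** Write compositions of permutations as composites of functions. The covering
map sends (b Dis_e, j, j') to U^-j T^-j' b (e), which makes sense because U and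
T have order dividing n and b (e) depends on the coset of b only.

At level at most 2 every sigma_x acts on the classes of approx as T, every
tau_x as T^-1, U as T^-1, and the elements of Dis act trivially. Hence, for b in
Dis, U (b z) = sigma_z^-1 b z, because sigma_(b z) = sigma_z; that is,
U b U^-1 agrees with sigma_z^-1 b sigma_z at U z, and T b T^-1 agrees with
tau_z^-1 b tau_z at T z. By the braid relation neither conjugate depends on z,
and both merely shift the indices of the generators sigma_x sigma_y^-1 and
tau_x tau_y^-1 of Dis: conjugation by U applies T^-1 to x and y, conjugation by
T applies T.
This is the content of [shiftable_sigma] and [shiftable_tau].

The map is a homomorphism for the following reason. Let y = U^-j T^-j' p (e) and
w = U^-1 y. By definition of U, sigma_w y = w, so
sigma_x y = (sigma_x sigma_w^-1) w with w = U^-(j+1) T^-j' p (e). Moving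
sigma_x sigma_w^-1 to the right past U^-(j+1) T^-j' shifts it by j' - j - 1,
which takes w into the class of e and x, in the class of T^(i-i') e, into that
of T^(i-i'+j'-j-1) e: the result is a representative of the entry of c that
occurs in the affine solution. With T in place of U the same computation gives
tau_x, and the entry of d; see [diff_frame].

Surjectivity: each x is equivalent under approx to some value of the map, so the
range is stable under all sigma_x and tau_x, contains e, and is therefore
everything by indecomposability. *)

Set Implicit Arguments.
Unset Strict Implicit.
Unset Printing Implicit Defensive.

Import GroupScope GRing.Theory.

(** * U, T and the displacement group at level at most 2 *)

Section LevelTwo.

Variable X : solution.
Hypothesis lev2 : mpl_le2 X.
Implicit Types x y z w : X.

Notation U := (Uperm X).
Notation T := (Tperm X).

Lemma approx_eq_sigma {x y} : approx x y -> sigma x = sigma y.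
Proof. by case/andP=> /eqP. Qed.

Lemma approx_eq_tau {x y} : approx x y -> tau x = tau y.
Proof. by case/andP=> _ /eqP. Qed.

Lemma approx_perm (f g : {perm X}) :
  (forall x, approx (f x) (g x)) -> (forall x y, approx x y -> approx (g x) (g y)) ->
  forall x y, approx x y -> approx (f x) (f y).
Proof.
move=> fg gA x y /gA Axy; apply: approx_trans (fg x) _.
by apply: approx_trans Axy _; rewrite approx_sym.
Qed.

Lemma approx_T x y : approx x y -> approx (T x) (T y).
Proof.
apply: (@approx_perm T (sigma x)) => [z|u v].
  by rewrite approx_sym approx_Tperm.
exact/approx_sigma/approx_refl.
Qed.

Lemma approx_TV x y : approx x y -> approx (T^-1 x) (T^-1 y).
Proof.
apply: (@approx_perm T^-1 (tau x)) => [z|u v].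
  by rewrite approx_sym approx_TpermV.
exact/approx_tau/approx_refl.
Qed.

(** This turns sigma_x y into (sigma_x sigma_w^-1) w with w = U^-1 y. *)
Lemma sigma_UV x : sigma (U^-1 x) x = U^-1 x.
Proof. by rewrite -{2}(permKV U x) [U _](permE (@U_inj X)) sigma_U. Qed.

Lemma tau_TV x : tau (T^-1 x) x = T^-1 x.
Proof. by rewrite -{2}(permKV T x) [T _](permE (@T_inj X)) tau_T. Qed.

Lemma approx_UV x : approx (U^-1 x) (T x).
Proof. by rewrite -sigma_UV approx_Tperm. Qed.

Lemma approx_U x : approx (U x) (T^-1 x).
Proof.
rewrite -{2}(permK U x) -[X in approx X _](permK T); apply: approx_TV.
by rewrite approx_sym approx_UV.
Qed.

(** The middle component of the braid relation, sigma_a tau_z = tau_b sigma_x,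
with the indices a and b replaced by equivalent ones that do not depend on the
point to which both sides are applied. *)
Lemma sigma_tau_exchange x z :
  tau z * sigma (T^-1 x) = sigma x * tau (T z).
Proof.
apply/permP=> w; rewrite !permM.
rewrite -(approx_eq_sigma (approx_TpermV lev2 x (sigma w z))).
by rewrite -(approx_eq_tau (approx_Tperm lev2 z (tau w x))) braid2.
Qed.

(** U (T x) is the preimage of x under tau_x sigma_(T x), and T (U x) is its
preimage under sigma_x tau_(U x); the exchange law identifies these two maps. *)
Lemma commute_UT : commute U T.
Proof.
apply/permP=> x; rewrite !permM.
have ET w : tau w (T w) = w by rewrite permE tau_T.
have EU w : sigma w (U w) = w by rewrite permE sigma_U.
have E w : sigma x (tau (U x) w) = tau x (sigma (T x) w).
  have := sigma_tau_exchange (T x) (T^-1 x).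
  rewrite permK permKV -(approx_eq_tau (approx_U x)).
  by move/permP/(_ w); rewrite !permM.
apply: (@perm_inj _ (sigma (T x))); apply: (@perm_inj _ (tau x)).
by rewrite -E ET !EU ET.
Qed.

Definition diff (s : X -> {perm X}) x y : {perm X} := (s y)^-1 * s x.

(** What the covering argument uses of sigma and tau, so that it is carried out
once for both. *)
Record shiftable (s : X -> {perm X}) : Prop := Shiftable {
  shiftable_approx : forall x y, approx x y -> s x = s y;
  shiftable_Dis : forall x y, diff s x y \in Dis X;
  shiftable_U : forall x y, diff s x y ^ U = diff s (T^-1 x) (T^-1 y);
  shiftable_T : forall x y, diff s x y ^ T = diff s (T x) (T y)
}.

Lemma Dis_approx p z : p \in Dis X -> approx (p z) z.
Proof.
move: p z; have gen p z : p \in [set (sigma y)^-1 * sigma x | x : X, y : X]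
     :|: [set (tau y)^-1 * tau x | x : X, y : X] -> approx (p z) z.
  case/setUP=> /imset2P[x y _ _ ->]; rewrite permM.
    by rewrite -{2}(permKV (sigma y) z) level2_sigma.
  by rewrite -{2}(permKV (tau y) z) level2_tau.
move=> p z /gen_prodgP[k [f fA ->]].
elim: k f fA z => [|k IHk] f fA z; first by rewrite big_ord0 perm1 approx_refl.
rewrite big_ord_recl permM.
apply: (approx_trans (IHk _ (fun i => fA _) _)); exact: gen (fA _).
Qed.

(** D is the diagonal map U or T. As g z is equivalent to z, the permutation
s (g z) is s z, so D (g z) = (s z)^-1 (g z) and D g D^-1 acts at D z as the
conjugate of g by s z. *)
Lemma conj_of_diagonal (s : X -> {perm X}) (D : {perm X}) (g h : {perm X}) :
    (forall x y, approx x y -> s x = s y) -> (forall x, D x = (s x)^-1 x) ->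
    g \in Dis X -> (forall z, g ^ (s z)^-1 = h) -> g ^ D = h.
Proof.
move=> sA DE Dg gh; apply: (mulgI D); rewrite -conjgC; apply/permP=> z.
rewrite !permM !DE (sA _ _ (Dis_approx z Dg)) -(gh z) conjgE invgK.
by rewrite !permM permKV.
Qed.

Lemma shiftable_sigma : shiftable (@sigma X).
Proof.
split=> [x y|x y|x y|x y]; first exact: approx_eq_sigma.
- exact: sigma_Dis.
- apply: (@conj_of_diagonal (@sigma X)) => [||| z]; first exact: @approx_eq_sigma.
  + by move=> z; rewrite permE.
  + exact: sigma_Dis.
  rewrite conj_sigma_sigma // /diff.
  by rewrite !(approx_eq_sigma (approx_TpermV lev2 _ _)).
apply: (@conj_of_diagonal (@tau X)) => [||| z]; first exact: @approx_eq_tau.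
- by move=> z; rewrite permE.
- exact: sigma_Dis.
by rewrite conj_sigma_tauV // /diff !permE.
Qed.

Lemma shiftable_tau : shiftable (@tau X).
Proof.
split=> [x y|x y|x y|x y]; first exact: approx_eq_tau.
- exact: tau_Dis.
- apply: (@conj_of_diagonal (@sigma X)) => [||| z]; first exact: @approx_eq_sigma.
  + by move=> z; rewrite permE.
  + exact: tau_Dis.
  (* The exchange law shows that conjugation by sigma z shifts by T. *)
  have E v : tau (T v) = (sigma (T z))^-1 * tau v * sigma z.
    by rewrite -mulgA -{2}(permK T z) sigma_tau_exchange mulKg.
  apply: (conjg_inj (sigma z)); rewrite conjgKV /diff conjgE.
  rewrite -{1}(permKV T x) -{1}(permKV T y) !E !invMg invgK !mulgA.
  by rewrite mulgK.
apply: (@conj_of_diagonal (@tau X)) => [||| z]; first exact: @approx_eq_tau.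
- by move=> z; rewrite permE.
- exact: tau_Dis.
rewrite conj_tau_tau // /diff.
by rewrite !(approx_eq_tau (approx_Tperm lev2 _ _)).
Qed.

Lemma approx_TX k x y : approx x y -> approx ((T ^+ k) x) ((T ^+ k) y).
Proof.
elim: k => [|k IHk] Axy; first by rewrite !perm1.
by rewrite expgSr !permM; apply/approx_T/IHk.
Qed.

Lemma approx_TVX k x y : approx x y -> approx ((T ^- k) x) ((T ^- k) y).
Proof.
rewrite -expVgn; elim: k => [|k IHk] Axy; first by rewrite !perm1.
by rewrite expgSr !permM; apply/approx_TV/IHk.
Qed.

Lemma approx_UVX k x : approx ((U ^- k) x) ((T ^+ k) x).
Proof.
rewrite -expVgn; elim: k => [|k IHk]; first by rewrite !perm1 approx_refl.
rewrite !expgSr !permM; apply: approx_trans (approx_UV _) _.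
exact: approx_T.
Qed.

(** * Translating the displacement group along U and T *)

Definition frame j j' : {perm X} := U ^- j * T ^- j'.

Lemma frameSl j j' : frame j.+1 j' = frame j j' * U^-1.
Proof.
rewrite /frame expgS invMg -!mulgA; congr (_ * _).
exact/commuteV/commute_sym/commuteV/commute_sym/commuteX/commute_UT.
Qed.

Lemma frameSr j j' : frame j j'.+1 = frame j j' * T^-1.
Proof. by rewrite /frame expgS invMg mulgA. Qed.

Lemma approx_frame j j' x : approx (frame j j' x) ((T ^+ j * T ^- j') x).
Proof. by rewrite !permM; apply/approx_TVX/approx_UVX. Qed.

Lemma diff_conj_frame s j j' x y : shiftable s ->
  diff s x y ^ (frame j j')^-1 =
  diff s ((T ^+ j' * T ^- j) x) ((T ^+ j' * T ^- j) y).
Proof.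
move=> ss; rewrite invMg !invgK conjgM !permM.
have -> : diff s x y ^ (T ^+ j') = diff s ((T ^+ j') x) ((T ^+ j') y).
  elim: j' => [|k IHk]; first by rewrite conjg1 !perm1.
  by rewrite expgSr conjgM IHk (shiftable_T ss) !permM.
move: (_ x) (_ y) => {}x {}y; rewrite -expVgn.
elim: j => [|k IHk]; first by rewrite conjg1 !perm1.
by rewrite !expgSr conjgM IHk (shiftable_U ss) !permM.
Qed.

(** The core computation: the displacement from w to x, applied to w itself, can
be carried through the frame, which shifts it into a displacement based at e,
since the shift takes w into the class of e. *)
Lemma diff_frame s j j' p e x : shiftable s -> p \in Dis X ->
  diff s x ((p * frame j j') e) ((p * frame j j') e) =
  (p * diff s ((T ^+ j' * T ^- j) x) e * frame j j') e.
Proof.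
move=> ss Dp; set w := (p * frame j j') e.
have -> : diff s ((T ^+ j' * T ^- j) x) e = diff s x w ^ (frame j j')^-1.
  rewrite (diff_conj_frame _ _ _ _ ss) /diff; congr (_^-1 * _).
  apply: (shiftable_approx ss); rewrite approx_sym /w permM.
  rewrite permM; apply: (@approx_trans _ ((T ^- j) ((T ^+ j') ((T ^+ j * T ^- j') e)))).
    apply/approx_TVX/approx_TX; apply: approx_trans (approx_frame _ _ _) _.
    by rewrite !permM; apply/approx_TVX/approx_TX; apply: Dis_approx.
  by rewrite !permM permKV permK approx_refl.
have -> (g N : {perm X}) : p * g ^ N^-1 * N = p * N * g.
  by rewrite conjgE invgK -!mulgA mulVg mulg1.
by rewrite [RHS]permM.
Qed.

End LevelTwo.

(** * Exponents modulo n *)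

Section ZmodPower.

Variables (gT : finGroupType) (n : nat) (g : gT).
Hypotheses (n_gt0 : 0 < n) (gn : #[g] %| n).
Implicit Types i j : Zmod n.

Lemma expg_ZmodD i j : g ^+ (i + j)%R = g ^+ i * g ^+ j.
Proof.
rewrite -expgD /= expg_mod // prednK //; apply/eqP.
by rewrite -order_dvdn.
Qed.

Lemma expg_ZmodN i : g ^+ (- i)%R = g ^- i.
Proof. by apply: (mulgI (g ^+ i)); rewrite -expg_ZmodD subrr mulgV. Qed.

Lemma expg_Zmod1 : g ^+ (Zp1 : Zmod n) = g.
Proof.
by rewrite /= expg_mod ?expg1 // prednK //; apply/eqP; rewrite -order_dvdn.
Qed.

End ZmodPower.

(** * The covering map *)

Section CanonicalMap.

Variables (X : solution) (e : X).
Hypotheses (indec : indecomposable X) (lev2 : mpl_le2 X).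

Notation U := (Uperm X).
Notation T := (Tperm X).
Notation n := (canon_n X).
Notation C := (canonical_solution e indec lev2).
Notation cl p := (subg (canon_group e) (coset (Dis_stab e) p)).

Definition canon_map (y : C) : X :=
  let: (g, j, j') := y in (repr (set_of_coset (sgval g)) * frame X j j') e.

(** Computes the map from any representative: two representatives differ by an
element of the stabilizer of e, which acts first. *)
Lemma canon_mapE p (j j' : Zmod n) : p \in Dis X ->
  canon_map (cl p, j, j') = (p * frame X j j') e.
Proof.
move=> Dp; have Np := subsetP (Dis_norm e lev2) p Dp.
rewrite /canon_map sgval_canon // val_coset //.
have /rcosetP[a /setIP[_ /astab1P ae] ->] := mem_repr_rcoset (Dis_stab e) p.
by rewrite !permM; rewrite [a e]ae.
Qed.

Lemma cl_surj (g : subg_of (canon_group e)) : exists2 p, p \in Dis X & g = cl p.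
Proof.
have /morphimP[p _ Dp Eg] := subgP g; exists p => //.
by rewrite -[LHS]sgvalK Eg.
Qed.

Lemma clM p q : p \in Dis X -> q \in Dis X -> cl (p * q) = cl p * cl q.
Proof.
move=> Dp Dq; have N := subsetP (Dis_norm e lev2).
by rewrite morphM ?N // morphM //; apply: mem_quotient.
Qed.

Lemma canon_map_approx (g : subg_of (canon_group e)) (i i' : Zmod n) :
  approx (canon_map (g, i, i')) ((T ^+ i * T ^- i') e).
Proof.
have [p Dp ->] := cl_surj g; rewrite canon_mapE // permM.
apply: approx_trans (approx_frame lev2 _ _ _) _; rewrite !permM.
by apply/(approx_TVX lev2)/(approx_TX lev2)/Dis_approx.
Qed.

(** Common form of the two homomorphism equations. The naturals j0 and j0' stand
for j and j' computed without wrapping around modulo n; the last hypothesis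
identifies the index k of the affine sequence with the index of x after its
shift by the frame. *)
Lemma canon_map_step (s : X -> {perm X}) (j0 j0' : nat) (i i' j j' k : Zmod n) g p :
    shiftable s -> p \in Dis X -> frame X j j' = frame X j0 j0' ->
    T ^+ k = T ^+ i * T ^- i' * (T ^+ j0' * T ^- j0) ->
  canon_map (cl p * cl (diff s (tilde e k) e), j, j') =
    diff s (canon_map (g, i, i')) ((p * frame X j0 j0') e) ((p * frame X j0 j0') e).
Proof.
move=> ss Dp Ef Ek; have Dq := shiftable_Dis ss (tilde e k) e.
rewrite -clM // canon_mapE; last exact: groupM.
rewrite Ef diff_frame //; set x := canon_map _.
suff E : s (tilde e k) = s ((T ^+ j0' * T ^- j0) x) by rewrite /diff E.
apply: (shiftable_approx ss); rewrite approx_sym /tilde Ek !permM.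
apply/(approx_TVX lev2)/(approx_TX lev2); rewrite -permM.
exact: canon_map_approx.
Qed.

Lemma canon_map_hom : homomorphism canon_map.
Proof.
have n_gt0 := canon_n_gt0 X.
have Tn : #[T] %| n := dvdn_lcmr _ _.
have Un : #[U] %| n := dvdn_lcml _ _.
have TE := (expg_ZmodD n_gt0 Tn, expg_ZmodN n_gt0 Tn, expg_Zmod1 n_gt0 Tn).
have UE := (expg_ZmodD n_gt0 Un, expg_ZmodN n_gt0 Un, expg_Zmod1 n_gt0 Un).
move=> [[g i] i']; split=> -[[h j] j']; have [p Dp ->] := cl_surj h.
  have -> : @sigma C (g, i, i') (cl p, j, j') =
      (cl p * canon_c e (i - i' + j' - j - Zp1)%R, (j + Zp1)%R, j') :> C.
    by rewrite /= permE.
  rewrite [in RHS]canon_mapE // /canon_c.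
  rewrite (@canon_map_step _ j.+1 j' i i' _ _ _ g _ (shiftable_sigma lev2) Dp).
  - rewrite frameSl // mulgA permM; set y := (p * _) e.
    by rewrite /diff permM -{2}(sigma_UV y) permK.
  - by rewrite /frame !UE expgSr.
  by rewrite !TE expgS invMg !mulgA.
have -> : @tau C (g, i, i') (cl p, j, j') =
    (cl p * canon_d e (i - i' + j' - j + Zp1)%R, j, (j' + Zp1)%R) :> C.
  by rewrite /= permE.
rewrite [in RHS]canon_mapE // /canon_d.
rewrite (@canon_map_step _ j j'.+1 i i' _ _ _ g _ (shiftable_tau lev2) Dp).
- rewrite frameSr // mulgA permM; set y := (p * _) e.
  by rewrite /diff permM -{2}(tau_TV y) permK.
- by rewrite /frame !TE expgSr.
rewrite !TE expgSr -!mulgA; do 3!congr (_ * _).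
exact/commute_sym/commuteV/commuteX.
Qed.

Lemma canon_map_surj x : exists y, canon_map y = x.
Proof.
pose S := [set z | [exists y : C, canon_map y == z]].
have S_e : e \in S.
  rewrite inE; apply/existsP; exists (1, 0%R, 0%R); apply/eqP.
  have <- : cl 1 = 1 by rewrite !morph1.
  by rewrite canon_mapE // mul1g /frame !expg0 invg1 mulg1 perm1.
have approxS z : exists y, approx z (canon_map y).
  have [i Az] := tilde_approx e indec lev2 z.
  (* The values at (g, i, i') lie in the class of T^(i - i') e. *)
  exists (1, 0%R, (- i)%R); apply: approx_trans Az _; rewrite approx_sym.
  apply: approx_trans (canon_map_approx _ _ _) _.
  by rewrite mul1g expg_ZmodN ?invgK ?canon_n_gt0 ?dvdn_lcmr.
have nS : perm_group X \subset 'N(S | 'P).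
  rewrite gen_subG; apply/subsetP => _ /setUP[] /imsetP[z _ ->];
    rewrite !inE /=; apply/subsetP => w; rewrite !inE => /existsP[v /eqP <-];
    have [y Ay] := approxS z; have [Hs Ht] := canon_map_hom y; apply/existsP.
  - by exists (sigma y v); rewrite Hs (approx_eq_sigma Ay).
  by exists (tau y v); rewrite Ht (approx_eq_tau Ay).
have [a Ga ->] := atransP2 indec (in_setT e) (in_setT x).
have : 'P%act e a \in S by rewrite (astabs_act _ (subsetP nS a Ga)).
by rewrite inE => /existsP[y /eqP]; exists y.
Qed.

End CanonicalMap.

Theorem corollary6p3 (X : solution) (indec : indecomposable X) (lev2 : mpl_le2 X)
  (e : X) : homomorphic_image X (canonical_solution e indec lev2).
Proof.
exists (@canon_map X e indec lev2); first exact: canon_map_hom.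
exact: canon_map_surj.
Qed.
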